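(* For every $n\ge1$ and every $\pi\in\mathrm{NCCP}(n;312)$, $$c\big((\psi\circ\phi^{-1})(\pi)\big)=\beta(\pi),$$ i.e. the triangle formed by $\psi\circ\phi^{-1}:\mathrm{NCCP}(n;312)\to\mathrm{NCP}(n)$, the Kreweras complement map $c:\mathrm{NCP}(n)\to\mathrm{NCP}(n)$, and $\beta:\mathrm{NCCP}(n;312)\to\mathrm{NCP}(n)$ is commutative.
   Context: **Noncommutative crossing partitions.** Let $[n]=\{1,\dots,n\}$. A noncommutative crossing partition of $[n]$ is a finite sequence $\pi=(\pi_1,\dots,\pi_l)$, written $\pi_1/\cdots/\pi_l$, of nonempty blocks such that each $p\in[n]$ appears exactly once, each block is written increasingly, and $\max(\pi_i)>\min(\pi_{i+1})$ for $1\le i\le l-1$. $\mathrm{NCCP}(n)$ is the set of these. Concatenating the blocks gives a permutation of $[n]$ in one-line notation which determines $\pi$ (slashes sit exactly at the descents); $\pi$ is identified with this permutation. $\mathrm{NCCP}(n;312)$ is the subset of those $\pi$ whose permutation avoids the pattern $312$. $\mathrm{NCP}(n)$ is the set of $\pi\in\mathrm{NCCP}(n)$ that are non-crossing (no $a<b<c<d$ and $i\neq j$ with $a,c\in\pi_i$, $b,d\in\pi_j$) and canonical ($\min(\pi_l)<\cdots<\min(\pi_1)$). **Maps $\phi$ and $\psi$.** A labeled binary tree with $n$ nodes is a rooted tree in which each node has at most one left child and at most one right child, labeled bijectively by $[n]$ with labels increasing from root to leaves. $\phi$ sends such a tree to the permutation obtained by reading labels in in-order (left subtree, root, right subtree);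 it is a bijection onto $\mathrm{NCCP}(n)$. $\psi$ sends such a tree to the canonical partition obtained by deleting all left edges, taking the labels of each resulting chain of right edges as a block, and arranging blocks with decreasing minima. The map $\psi\circ\phi^{-1}$ restricts to a bijection $\mathrm{NCCP}(n;312)\to\mathrm{NCP}(n)$. **Kreweras complement $c$.** Place points $1,1',2,2',\dots,n,n'$ clockwise on a circle in this order. For $\pi\in\mathrm{NCP}(n)$ draw the convex hulls of its blocks on the unprimed points; $i'$ and $j'$ are in the same block of $c(\pi)$ iff they lie in the same region of the complement in the disc. Dropping primes and arranging blocks in canonical order (decreasing minima) gives $c(\pi)\in\mathrm{NCP}(n)$. **The map $\beta$.** Let $\omega$ be a sequence of distinct integers; its blocks are its maximal increasing runs (a slash is inserted at each descent). For an entry $i$ of $\omega$, define the sequence $\mu(\omega;i)=(\mu_1<\mu_2<\cdots<\mu_p)$ as follows: $\mu_1=i$, then scan the blocks of $\omega$ lying to the left of the block of $i$ from right to left, and append the maximum of a block whenever it is larger than the last element appended. Define $\lambda_1=\mu(\omega;\min\omega)$; delete the elements of $\lambda_1$ from $\omega$, and (with blocks recomputed for the remaining sequence) let $\lambda_2=\mu(\omega;\min\omega)$ for the new $\omega$; continue until $\omega$ is empty, obtaining $\lambda_1,\dots,\lambda_q$. Then $\beta(\omega)=\lambda_q/\lambda_{q-1}/\cdots/\lambda_1$. For $\omega\in\mathrm{NCCP}(n;312)$ (viewed as a permutation), $\beta(\omega)\in\mathrm{NCP}(n)$. E.g. $\beta(23/15/478/6)=7/68/45/2/13$. *)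

(* Defs.v *)
From HB Require Import structures.
From mathcomp Require Import all_boot all_order all_algebra.
From mathcomp Require Import all_classical all_reals all_analysis.

Set Implicit Arguments.
Unset Strict Implicit.
Unset Printing Implicit Defensive.

Import Order.TTheory GRing.Theory Num.Theory.
Import numFieldNormedType.Exports.

Local Open Scope classical_set_scope.

(* Blocks are written increasingly, so their minimum (resp. maximum) is their
   first (resp. last) entry. *)
Definition bmin (b : seq nat) : nat := head 0 b.
Definition bmax (b : seq nat) : nat := last 0 b.

(* The permutation (one-line notation) identified with a noncommutative
   crossing partition p is [flatten p]. *)
Definition NCCP (n : nat) : set (seq (seq nat)) :=
  [set p | [/\ all (fun b => b != [::]) p,
               perm_eq (flatten p) (iota 1 n),
               all (sorted ltn) p
             & sorted (fun b c => bmin c < bmax b) p]].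

Definition avoids312 (w : seq nat) : Prop :=
  forall i j k : nat, i < j -> j < k -> k < size w ->
    ~ (nth 0 w j < nth 0 w k /\ nth 0 w k < nth 0 w i).

Definition NCCP312 (n : nat) : set (seq (seq nat)) :=
  [set p | NCCP n p /\ avoids312 (flatten p)].

(* Maximal increasing runs of a word with distinct letters. *)
Fixpoint runs (w : seq nat) : seq (seq nat) :=
  if w is x :: w' then
    match runs w' with
    | b :: bs => if x < bmin b then (x :: b) :: bs else [:: x] :: b :: bs
    | [::] => [:: [:: x]]
    end
  else [::].

(* Rearranges a set partition so that the minima of the blocks decrease. *)
Definition canonical (p : seq (seq nat)) : seq (seq nat) :=
  sort (fun b c => bmin c <= bmin b) p.

Inductive tree : Type := Leaf | Node of tree & nat & tree.

HB.instance Definition _ := gen_eqMixin tree.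
HB.instance Definition _ := gen_choiceMixin tree.

Fixpoint inorder (t : tree) : seq nat :=
  if t is Node l x r then inorder l ++ x :: inorder r else [::].

Fixpoint increasing_tree (t : tree) : bool :=
  if t is Node l x r then
    [&& all (ltn x) (inorder l), all (ltn x) (inorder r),
        increasing_tree l & increasing_tree r]
  else true.

Definition labeled_trees (n : nat) : set tree :=
  [set t | increasing_tree t && perm_eq (inorder t) (iota 1 n)].

Definition phi (t : tree) : seq (seq nat) := runs (inorder t).

(* The default value Leaf is irrelevant on NCCP n, onto which phi maps
   labeled_trees n bijectively. *)
Definition phi_inv (n : nat) : seq (seq nat) -> tree :=
  'pinv_(fun=> Leaf) (labeled_trees n) phi.

Fixpoint right_chain (t : tree) : seq nat :=
  if t is Node _ x r then x :: right_chain r else [::].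

(* All chains of right edges left once the left edges are deleted; the chain
   of the root comes first, hence [behead]. *)
Fixpoint chains (t : tree) : seq (seq nat) :=
  if t is Node l x r then
    (x :: right_chain r) :: behead (chains r) ++ chains l
  else [::].

Definition psi (t : tree) : seq (seq nat) := canonical (chains t).

Section Kreweras.
Local Open Scope ring_scope.
Variables (R : realType) (n : nat).

(* As t increases from 1 to n + 1, this point runs clockwise once around the
   unit circle. *)
Definition circle_point (t : R) : R * R :=
  (sin (2 * pi * t / n%:R), cos (2 * pi * t / n%:R)).

Definition vertex (i : nat) : R * R := circle_point i%:R.
Definition primed_vertex (i : nat) : R * R := circle_point (i%:R + 2^-1).

Definition disc : set (R * R) := [set z | z.1 ^+ 2 + z.2 ^+ 2 <= 1].

Definition block_hull (b : seq nat) : set (R * R) :=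
  [set z | exists w : nat -> R,
    [/\ forall i, 0 <= w i,
        \sum_(i <- b) w i = 1,
        z.1 = \sum_(i <- b) w i * (vertex i).1
      & z.2 = \sum_(i <- b) w i * (vertex i).2]].

Definition same_region (p : seq (seq nat)) (i j : nat) : Prop :=
  connected_component (disc `\` \bigcup_(b in [set` p]) block_hull b)
    (primed_vertex i) (primed_vertex j).

Definition kreweras (p : seq (seq nat)) : seq (seq nat) :=
  canonical (undup [seq [seq j <- iota 1 n | `[< same_region p i j >]]
                   | i <- iota 1 n]).

End Kreweras.

Definition mu (w : seq nat) (i : nat) : seq nat :=
  let bs := runs w in
  let left_blocks := take (find (fun b => i \in b) bs) bs in
  foldl (fun m b => if last i m < bmax b then rcons m (bmax b) else m)
    [:: i] (rev left_blocks).

Definition wmin (w : seq nat) : nat := foldr minn (head 0 w) w.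

(* lambda_1, lambda_2, ... ; each step deletes at least the minimum of the
   word, so [size w] steps exhaust it. *)
Fixpoint lambdas (fuel : nat) (w : seq nat) : seq (seq nat) :=
  match fuel, w with
  | k.+1, _ :: _ =>
      let l := mu w (wmin w) in l :: lambdas k [seq x <- w | x \notin l]
  | _, _ => [::]
  end.

Definition beta (w : seq nat) : seq (seq nat) := rev (lambdas (size w) w).

(* Main.v *)
(* Proof idea.  On the circle, i' and j' lie in the same region iff the line
   i'j' cuts no block: if two points of a block lie on different sides of it,
   the line through them takes opposite signs at i' and j'; otherwise the
   segment i'j' misses all the hulls.  For increasing trees, 312-avoidance of
   the in-order word w says that the labels are the preorder numbering, and an
   induction on the tree shows that, for i < j, the complement relates i and j
   iff j is a right-to-left maximum of the prefix of w before i.  The map beta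
   reads off these maxima: deleting whole blocks of the complement never
   deletes a right-to-left maximum that is still needed. *)
Require Import Defs.
From mathcomp Require Import all_boot all_order all_algebra.
From mathcomp Require Import all_classical all_reals all_analysis.
From mathcomp Require Import lra ring zify.

Import Order.TTheory GRing.Theory Num.Theory.
Import numFieldNormedType.Exports.

(** * Right-to-left maxima and runs *)

(** Listed from left to right, hence decreasing; [mu] meets them in the opposite order, which
    explains the later uses of [rev]. *)
Fixpoint rl_maxima (u : seq nat) : seq nat :=
  if u is x :: u' then
    if all (fun y => y < x) u' then x :: rl_maxima u' else rl_maxima u'
  else [::].

Lemma rl_maxima_sub (u : seq nat) : {subset rl_maxima u <= u}.
Proof.
elim: u => //= x u IH y; case: ifP => _; rewrite !inE.
  by case/orP => [->//|/IH->]; rewrite orbT.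
by move/IH->; rewrite orbT.
Qed.

Lemma rl_maxima_ge (u : seq nat) (y : nat) :
  y \in u -> exists2 z, z \in rl_maxima u & y <= z.
Proof.
elim: u y => //= x u IH y; rewrite inE.
case: ifP => [ux|/negbT/allPn[z zu]]; last first.
  rewrite -leqNgt => xz /orP[/eqP->|/IH//].
  by have [t tu zt] := IH z zu; exists t => //; apply: leq_trans zt.
case/orP=> [/eqP->|/IH[z zu yz]].
  by exists x; rewrite ?inE ?eqxx.
by exists z; rewrite // inE zu orbT.
Qed.

Lemma rl_maxima_cat (u v : seq nat) :
  rl_maxima (u ++ v)
  = [seq x <- rl_maxima u | all (fun y => y < x) v] ++ rl_maxima v.
Proof.
elim: u => //= x u ->; rewrite all_cat.
by case: (all _ u) => //=; case: ifP.
Qed.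

Lemma rl_maxima_sorted (u : seq nat) : sorted gtn (rl_maxima u).
Proof.
elim: u => //= x u IH; case: ifP => //= ux.
rewrite path_sortedE; last by move=> y z t; lia.
by rewrite IH andbT; apply/allP => y /rl_maxima_sub /(allP ux).
Qed.

(** Deletion creates no new maximum: a kept letter exceeds [m], and if it is not a maximum of [u],
    some larger maximum to its right also exceeds [m] and is therefore kept. *)
Lemma rl_maxima_filter (u : seq nat) (P : pred nat) (m : nat) :
  {in rl_maxima u, forall x, m < x -> P x} ->
  {in u, forall x, P x -> m < x} ->
  rl_maxima [seq x <- u | P x] = [seq x <- rl_maxima u | m < x].
Proof.
elim: u => //= x u IH H1 H2.
have {}IH : rl_maxima [seq x <- u | P x] = [seq x <- rl_maxima u | m < x].
  apply: IH => y yu; last by apply: H2; rewrite inE yu orbT.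
  by apply: H1; case: ifP; rewrite // inE yu orbT.
have [Px|nPx] := boolP (P x); have [ux|ux] := boolP (all _ u) => //=.
- rewrite IH H2 ?inE ?eqxx //.
  case: ifP => // /negbT/allPn[z]; rewrite mem_filter => /andP[_ zu].
  by rewrite (allP ux).
- rewrite IH; case: ifP => //= /allP Pu.
  have [z zu xz] := allPn ux; have [t tu zt] := rl_maxima_ge _ _ zu.
  have mx : m < x by rewrite H2 ?inE ?eqxx.
  rewrite -leqNgt in xz.
  have : t < x.
    rewrite Pu // mem_filter (rl_maxima_sub _ _ tu) H1 ?(negPf ux) //.
    by rewrite (leq_trans mx) // (leq_trans xz).
  by rewrite ltnNge (leq_trans xz).
- rewrite ifF //; apply: contraNF nPx => mx.
  by rewrite H1 // ux inE eqxx.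
Qed.

Lemma runs_cons (x : nat) (w : seq nat) :
  runs (x :: w) = match runs w with
    | b :: bs => if x < bmin b then (x :: b) :: bs else [:: x] :: b :: bs
    | [::] => [:: [:: x]]
    end.
Proof. by []. Qed.

Lemma runs_neq0 (x : nat) (w : seq nat) :
  exists b bs, runs (x :: w) = (x :: b) :: bs.
Proof.
rewrite /=; case: (runs w) => [|b bs]; first by exists [::], [::].
by case: ifP => _; [exists b, bs|exists [::], (b :: bs)].
Qed.

Lemma flatten_runs (w : seq nat) : flatten (runs w) = w.
Proof.
elim: w => // x w /=; case: (runs w) => [|b bs] /= <-; first by [].
by case: ifP.
Qed.

(** No run crosses the junction, because there is no ascent there. *)
Lemma runs_cat (u v : seq nat) :
  (v != [::] -> u != [::] -> head 0 v <= last 0 u) -> runs (u ++ v) = runs u ++ runs v.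
Proof.
elim: u => // x [|y u] IH.
  case: v {IH} => [|y v]; first by rewrite cats0.
  have [b [bs E]] := runs_neq0 y v.
  by move=> /(_ isT isT) yx; rewrite cat1s runs_cons E /= ltnNge yx.
move=> H; have {}IH := IH H; have [b [bs E]] := runs_neq0 y u.
rewrite cat_cons runs_cons IH (runs_cons x) E /=.
by case: ifP.
Qed.

Lemma runs_sorted (b : seq nat) : b != [::] -> sorted ltn b -> runs b = [:: b].
Proof.
elim: b => // x [|y b] IH // _ sb.
have /andP[xy yb] : (x < y) && sorted ltn (y :: b) := sb.
by rewrite runs_cons (IH isT yb) /= xy.
Qed.

Lemma runs_flatten (p : seq (seq nat)) :
  all (fun b => b != [::]) p -> all (sorted ltn) p ->
  sorted (fun b c => bmin c < bmax b) p -> runs (flatten p) = p.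
Proof.
elim: p => // b p IH /= /andP[b0 p0] /andP[bs ps] pp.
rewrite runs_cat ?(runs_sorted b) ?IH //; first exact: path_sorted pp.
case: p pp p0 {IH ps} => // c p /= /andP[cb _] /andP[c0 _] _ _.
by case: c c0 cb => //= x c _ /ltnW.
Qed.

Lemma wminP (w : seq nat) : w != [::] -> wmin w \in w /\ {in w, forall x, wmin w <= x}.
Proof.
case: w => // y w _; rewrite /wmin [head 0 _]/=.
have : forall s, foldr minn y s \in y :: s /\ {in y :: s, forall x, foldr minn y s <= x}.
  elim=> [|x s [IH1 IH2]] /=; first by split=> [|z]; rewrite ?inE // => /eqP->.
  split; first by move: IH1; rewrite !inE; case: leqP => _; lia.
  move=> z; rewrite !inE => /or3P[zy|/eqP->|zs].
  - by rewrite geq_min IH2 ?orbT // inE zy.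
  - by rewrite geq_minl.
  - by rewrite geq_min IH2 ?orbT // inE zs orbT.
case/(_ (y :: w)) => H1 H2; split; last by move=> x xw; apply: H2; rewrite inE xw orbT.
by move: H1; rewrite !inE => /orP[->|].
Qed.

(** A right-to-left maximum is the last letter of its run, so scanning the maxima of the runs
    leftwards and keeping the records finds all of them. The letter [m] opens a run, so the runs to
    its left are exactly those of [u]. *)
Lemma mu_min (u v : seq nat) (m : nat) : m \notin u -> all (ltn m) u ->
  mu (u ++ m :: v) m = m :: rev (rl_maxima u).
Proof.
move=> mu0 /allP mu1; rewrite /mu runs_cat; last first.
  by case: u mu1 {mu0} => //= x u mu1 _ _; apply/ltnW/mu1/mem_last.
have [b [bs E]] := runs_neq0 m v.
have -> : find (fun b => m \in b) (runs u ++ runs (m :: v)) = size (runs u).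
  rewrite find_cat; have /negPf-> : ~~ has (fun b => m \in b) (runs u).
    apply: contra mu0 => /hasP[c cu mc].
    by rewrite -(flatten_runs u); apply/flattenP; exists c.
  by rewrite E /= inE eqxx addn0.
rewrite take_size_cat // foldl_rev.
(* The induction also carries that the last record bounds every letter seen so far; this decides
   whether the next letter is a record. *)
set F := fun _ _ => _; suff [] : foldr F [:: m] (runs u) = m :: rev (rl_maxima u) /\
   {in m :: u, forall y, y <= last m (rev (rl_maxima u))} by [].
elim: u mu1 {mu0 E} => [|x u IH] mu1; first by split=> // y; rewrite inE => /eqP->.
have {IH} [|IH1 IH2] := IH; first by move=> y yu; apply: mu1; rewrite inE yu orbT.
have mx : m < x by apply: mu1; rewrite inE eqxx.
have lastE : last m (rev (rl_maxima u)) < x -> all (fun y => y < x) u.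
  move=> lx; apply/allP => y yu; apply: leq_ltn_trans lx.
  by apply: IH2; rewrite inE yu orbT.
have allE : all (fun y => y < x) u -> last m (rev (rl_maxima u)) < x.
  move=> /allP ux; have := mem_last m (rev (rl_maxima u)); rewrite inE mem_rev.
  by case/orP=> [/eqP->//|/rl_maxima_sub/ux].
split; last first.
  move=> y; rewrite !inE => /or3P[/eqP->|/eqP->|yu] /=; case: ifP => ux;
    rewrite ?rev_cons ?last_rcons //.
  - by rewrite ltnW.
  - by rewrite IH2 // inE eqxx.
  - by rewrite leqNgt; apply/negP => /lastE; rewrite ux.
  - by rewrite ltnW // (allP ux).
  - by rewrite IH2 // inE yu orbT.
(* Either [x] is a new run by itself and the fold makes one more step, or it extends the first run,
   whose maximum is unchanged; then [x] is below the last record and nothing is appended. *)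
have -> : foldr F [:: m] (runs (x :: u)) =
  if last m (rev (rl_maxima u)) < x then rcons (m :: rev (rl_maxima u)) x
  else m :: rev (rl_maxima u).
  case: u IH1 IH2 lastE allE {mu1} => [|y u] IH1 IH2 lastE allE; first by [].
  have [c [cs E']] := runs_neq0 y u.
  rewrite E' in IH1; rewrite runs_cons E' [bmin _]/=.
  move: IH2 lastE {allE}; set r := last m _ => IH2 lastE.
  case: (ltnP x y) => [xy|yx]; last first.
    by rewrite -[LHS]/(F [:: x] (foldr F [:: m] ((y :: c) :: cs))) IH1.
  by rewrite -[LHS]/(foldr F [:: m] ((y :: c) :: cs)) IH1 [RHS]ifN //
    -leqNgt (leq_trans (ltnW xy)) // IH2 // !inE eqxx orbT.
case: ltnP => [/lastE /= ->|]; first by rewrite rev_cons.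
by rewrite leqNgt => /negP lx /=; case: ifP => // /allE.
Qed.

(** Comparing minima is antisymmetric on the blocks of [q], since these minima strictly decrease;
    the sorted arrangement is therefore unique. *)
Lemma canonicalE (p q : seq (seq nat)) :
  sorted (fun b c => bmin c < bmin b) q -> uniq p -> p =i q -> Defs.canonical p = q.
Proof.
move=> sq up pq; rewrite /Defs.canonical.
pose gt (b c : seq nat) := bmin c < bmin b.
have gtt : transitive gt by move=> a b c; rewrite /gt; lia.
have gti : irreflexive gt by move=> a; rewrite /gt; lia.
have uq : uniq q by apply: (sorted_uniq gtt gti).
have perm : perm_eq (sort (fun b c => bmin c <= bmin b) p) q.
  by rewrite perm_sort; apply: uniq_perm.
apply: (@sorted_eq_in _ (fun b c : seq nat => bmin c <= bmin b) _ _ _ _ _ _ perm).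
- by move=> a b c _ _ _ ba ac; apply: leq_trans ac ba.
- move=> b c; rewrite !mem_sort !pq => bq cq /andP[cb bc].
  have bceq : bmin b = bmin c by apply/eqP; rewrite eqn_leq cb bc.
  apply/eqP/negPn/negP => neq.
  have idx (x y : seq nat) : x \in q -> y \in q -> index x q < index y q -> gt x y.
    by move=> xq yq; apply: (sorted_ltn_index gtt sq).
  have : index b q != index c q.
    by apply: contraNneq neq => bc'; rewrite -(nth_index [::] bq) bc' nth_index.
  by rewrite neq_ltn => /orP[/idx|/idx]; rewrite /gt bceq ltnn => /(_ _ _)/negP; case.
- by apply: sort_sorted => b c; apply: leq_total.
- by apply: sub_sorted sq => b c /ltnW.
Qed.

(** * The complement relation on trees *)

(** When [P] is one side of a line, this says that the line does not cut the block. *)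
Definition homogeneous (P : pred nat) (b : seq nat) : bool :=
  all P b || ~~ has P b.

Lemma homogeneousP (P : pred nat) (b : seq nat) :
  reflect {in b &, forall a c, P a = P c} (homogeneous P b).
Proof.
apply: (iffP orP) => [[/allP bP|/hasPn bP] a c ab cb|bP].
- by rewrite !bP.
- by rewrite !(negPf (bP _ _)).
- have [/hasP[a ab Pa]|] := boolP (has P b); last by right.
  by left; apply/allP => c cb; rewrite (bP c a).
Qed.

(** On the letters of [cs], the set [P] is a union of blocks. *)
Definition saturated (cs : seq (seq nat)) (P : pred nat) : bool :=
  all (homogeneous P) cs.

(* Labels increase in preorder. *)
Fixpoint ordered_tree (t : tree) : bool :=
  if t is Node l x r then
    [&& all (ltn x) (inorder l), all (ltn x) (inorder r),
        allrel ltn (inorder l) (inorder r), ordered_tree l & ordered_tree r]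
  else true.

Lemma avoids312_cat (u v : seq nat) :
  avoids312 (u ++ v) -> avoids312 u /\ avoids312 v.
Proof.
move=> uv; split=> i j k ij jk ks.
  have /= := uv i j k ij jk; rewrite size_cat !nth_cat.
  by rewrite ks (ltn_trans jk ks) (ltn_trans ij (ltn_trans jk ks)); apply; rewrite ltn_addr.
have /= := uv (size u + i) (size u + j) (size u + k).
rewrite !ltn_add2l !nth_cat !ltnNge !leq_addr /= !addKn size_cat leq_add2l -!ltnNge.
by move/(_ ij jk ks).
Qed.

Lemma avoids312_sep (u v : seq nat) (x y z : nat) :
  avoids312 (u ++ x :: v) -> y \in u -> z \in v -> x < z -> y <= z.
Proof.
move=> A yu zv xz; rewrite leqNgt; apply/negP => zy.
have yi : index y u < size u by rewrite index_mem.
have zi : index z v < size v by rewrite index_mem.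
apply: (A (index y u) (size u) (size u + (index z v).+1)) => //.
- by rewrite -[X in X < _]addn0 ltn_add2l.
- by rewrite size_cat ltn_add2l.
rewrite !nth_cat yi ltnn subnn [size u + _ < _]ltnNge leq_addr addKn /=.
by rewrite !nth_index.
Qed.

(** In the in-order word the root stands between the two subtrees and is smaller than both, so a
    left label above a right label would complete a 312 pattern. *)
Lemma avoids312_ordered (t : tree) :
  increasing_tree t -> uniq (inorder t) -> avoids312 (inorder t) -> ordered_tree t.
Proof.
elim: t => //= l IHl x r IHr /and4P[xl xr il ir].
rewrite cat_uniq => /and3P[ul /hasPn lr /= /andP[_ ur]] A.
have [Al] := avoids312_cat _ _ A; rewrite -cat1s => /avoids312_cat[_ Ar].
rewrite xl xr IHl ?IHr //= andbT; apply/allrelP => y z yl zr.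
have yz : y <= z by apply: (avoids312_sep _ _ _ _ _ A) => //; exact: (allP xr).
rewrite /= ltn_neqAle yz andbT.
by apply: contraTneq yl => ->; apply: lr; rewrite inE zr orbT.
Qed.

(** The minimum of the word must be the root; the factors before and after it give the subtrees. *)
Lemma increasing_tree_exists (w : seq nat) : uniq w ->
  exists2 t, increasing_tree t & inorder t = w.
Proof.
move: {2}(size w) (leqnn (size w)) => k; elim: k w => [|k IH] w.
  by rewrite leqn0 size_eq0 => /eqP-> _; exists Leaf.
have [->|w0] := eqVneq w [::]; first by exists Leaf.
have [] := wminP w w0; set m := wmin w => mw wm sw uw.
case/splitPr: mw wm sw uw => u v wm sw.
rewrite cat_uniq => /and3P[uu /hasPn uv /= /andP[mv vv]].
move: sw; rewrite size_cat /= => sw.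
have [l il El] : exists2 t, increasing_tree t & inorder t = u by apply: IH => //; lia.
have [r ir Er] : exists2 t, increasing_tree t & inorder t = v by apply: IH => //; lia.
exists (Node l m r); rewrite /= El Er // il ir !andbT.
apply/andP; split; apply/allP => y yu /=; rewrite ltn_neqAle wm
  ?mem_cat ?inE ?yu ?orbT // andbT.
  by apply: contraTneq yu => <-; apply: uv; rewrite inE eqxx.
by apply: contraNneq mv => ->.
Qed.

Lemma perm_chains (t : tree) : perm_eq (flatten (chains t)) (inorder t).
Proof.
(* The chain of the root is the head of [chains], so [behead] removes just the letters that
   [right_chain] puts back. *)
have chainsE : forall s, chains s =
    if s is Leaf then [::] else right_chain s :: behead (chains s).
  by case.
elim: t => //= l IHl x r IHr; rewrite perm_sym perm_catC /= perm_cons flatten_cat catA.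
apply: perm_cat; rewrite perm_sym //.
by move: IHr; rewrite [X in flatten X]chainsE; case: r.
Qed.

(** The root [x] joins the chain of the root [y] of [r], so the only new condition is that [P]
    agrees at [x] and [y]. *)
Lemma saturated_chains (l r : tree) (x : nat) (P : pred nat) :
  saturated (chains (Node l x r)) P =
  [&& saturated (chains l) P, saturated (chains r) P
    & if r is Node _ y _ then P x == P y else true].
Proof.
rewrite /saturated /homogeneous /= all_cat; case: r => [|rl y rr] /=.
  by rewrite !andbT orbF orbN.
case: (P x); case: (P y); case: (all P _); case: (has P _) => //=;
  by rewrite ?andbT ?andbF //= andbC.
Qed.

Lemma eq_saturated (cs : seq (seq nat)) (P Q : pred nat) :
  {in flatten cs, P =1 Q} -> saturated cs P = saturated cs Q.
Proof.
move=> PQ; apply: eq_in_all => b bc.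
have bPQ : {in b, P =1 Q} by move=> a ab; apply: PQ; apply/flattenP; exists b.
by rewrite /homogeneous (eq_in_all bPQ) (eq_in_has bPQ).
Qed.

Lemma eq_saturated_chains (t : tree) (P Q : pred nat) :
  {in inorder t, P =1 Q} -> saturated (chains t) P = saturated (chains t) Q.
Proof.
by move=> PQ; apply: eq_saturated => a; rewrite (perm_mem (perm_chains t)) => /PQ.
Qed.

Lemma saturated_const (cs : seq (seq nat)) (c : bool) : saturated cs (fun=> c).
Proof.
by apply/allP => b _; apply/homogeneousP.
Qed.

Lemma root_inorder (l r : tree) (x : nat) : x \in inorder (Node l x r).
Proof. by rewrite /= mem_cat inE eqxx orbT. Qed.

Lemma mem_rl_maxima_cat (u v : seq nat) (j : nat) : j \notin u ->
  (j \in rl_maxima (u ++ v)) = (j \in rl_maxima v).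
Proof.
move=> ju; rewrite rl_maxima_cat mem_cat mem_filter.
by case: (boolP (j \in rl_maxima u)) => [/rl_maxima_sub|]; rewrite ?(negPf ju) ?andbF.
Qed.

Lemma root_le (t : tree) (j : nat) : ordered_tree t -> j \in inorder t ->
  if t is Node _ y _ then y <= j else false.
Proof.
case: t => //= l y r /and3P[/allP yl /allP yr _].
by rewrite mem_cat inE => /or3P[/yl/ltnW|/eqP->|/yr/ltnW].
Qed.

(** This is the case of the next lemma in which [i] is the root and [j] lies in its left subtree:
    there the lower bound of the interval is vacuous. *)
Lemma saturated_initial (t : tree) (j : nat) : ordered_tree t -> j \in inorder t ->
  saturated (chains t) (fun a => a <= j) = (j \in rl_maxima (inorder t)).
Proof.
elim: t => // l IHl x r IHr; rewrite saturated_chains [ordered_tree _]/=.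
case/and5P=> /allP /= xl /allP /= xr /allrelP /= lr ol or.
rewrite mem_cat inE => /or3P[jl|/eqP->|jr].
- rewrite IHl // rl_maxima_cat mem_cat mem_filter.
  have nj : j \notin rl_maxima (x :: inorder r).
    apply/negP => /rl_maxima_sub; rewrite inE => /orP[/eqP jx|jr].
      by move: (xl _ jl); rewrite jx ltnn.
    by move: (lr _ _ jl jr); rewrite ltnn.
  rewrite (negPf nj) orbF andbC (@eq_saturated_chains r _ (fun=> false)); last first.
    by move=> a ar /=; rewrite leqNgt (lr _ _ jl ar).
  rewrite saturated_const; case: r {IHr nj} or lr xr => [|rl y rr] or lr xr /=.
    by rewrite (xl _ jl).
  (* A nonempty right subtree makes both sides false: its root exceeds [j] while [x] does not, and
     it stands to the right of [j] in the word. *)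
  have yr := root_inorder rl rr y.
  have jy := lr _ _ jl yr; rewrite all_cat /=.
  have yj : (y < j) = false by lia.
  by rewrite yj [y <= j]leqNgt jy (ltnW (xl _ jl)) !andbF.
- have xnl : x \notin inorder l by apply/negP => /xl; rewrite ltnn.
  rewrite mem_rl_maxima_cat // (@eq_saturated_chains l _ (fun=> false)); last first.
    by move=> a al /=; rewrite leqNgt xl.
  rewrite (@eq_saturated_chains r _ (fun=> false)); last first.
    by move=> a ar /=; rewrite leqNgt xr.
  rewrite !saturated_const; case: r {IHr} or lr xr => [|rl y rr] or lr xr.
    by rewrite inE eqxx.
  have yr := root_inorder rl rr y; have xy := xr _ yr.
  rewrite leqnn leqNgt xy /=.
  rewrite -/(inorder (Node rl y rr)) ifN; last first.
    by apply/allPn; exists y => //; rewrite -leqNgt ltnW.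
  by apply/esym/negbTE/negP => /rl_maxima_sub/xr; rewrite ltnn.
- have jx := xr _ jr.
  have jnl : j \notin inorder l by apply/negP => /lr/(_ jr); rewrite ltnn.
  rewrite mem_rl_maxima_cat // -cat1s mem_rl_maxima_cat ?inE ?gtn_eqF // -IHr //.
  rewrite (@eq_saturated_chains l _ (fun=> true)); last first.
    by move=> a al /=; rewrite ltnW // lr.
  rewrite saturated_const /=; have := root_le _ _ or jr.
  by case: r {xr lr or IHr jr} => // rl y rr ->; rewrite ltnW // andbT.
Qed.

(** Induction on the tree, according to the places of [i] and [j]: if both lie in one subtree, the
    rest of the tree adds no condition. *)
Lemma saturated_interval (t : tree) (i j : nat) : ordered_tree t ->
  i \in inorder t -> j \in inorder t -> i < j ->
  saturated (chains t) (fun a => i < a <= j)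
  = (j \in rl_maxima (take (index i (inorder t)) (inorder t))).
Proof.
elim: t => // l IHl x r IHr; rewrite saturated_chains [ordered_tree _]/=.
case/and5P=> /allP /= xl /allP /= xr /allrelP /= lr ol or.
rewrite !mem_cat !inE => it jt ij.
have xnl : x \notin inorder l by apply/negP => /xl; rewrite ltnn.
case/or3P: it => [il|/eqP ix|ir].
- have -> : take (index i (inorder l ++ x :: inorder r)) (inorder l ++ x :: inorder r)
      = take (index i (inorder l)) (inorder l).
    by rewrite index_cat il take_cat index_mem il.
  case/or3P: jt => [jl|/eqP jx|jr].
  + rewrite (IHl ol il jl ij) (@eq_saturated_chains r _ (fun=> false)); last first.
      by move=> a ar /=; rewrite [a <= j]leqNgt (lr _ _ jl ar) andbF.
    rewrite saturated_const; case: r {IHr} or lr xr => [|rl y rr] or lr xr; rewrite ?andbT //.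
    have jy := lr _ _ jl (root_inorder rl rr y).
    by rewrite [i < x]ltnNge (ltnW (xl _ il)) [y <= j]leqNgt jy andbF andbT.
  + by have := xl _ il; rewrite -jx ltnNge ltnW.
  (* Both sides are false: the interval contains the root of [r] but not [x], so it cuts their
     chain, and [j] stands after [i] in the word. *)
  + have jnl : j \notin inorder l by apply/negP => /lr/(_ jr); rewrite ltnn.
    rewrite [RHS]negbTE; last by apply: contra jnl => /rl_maxima_sub/mem_take.
    have := root_le _ _ or jr.
    case: r {IHr} or lr xr jr => [|rl y rr] or lr xr jr // yj.
    have iy := lr _ _ il (root_inorder rl rr y).
    by rewrite [i < x]ltnNge (ltnW (xl _ il)) iy yj /= !andbF.
- have -> : take (index i (inorder l ++ x :: inorder r)) (inorder l ++ x :: inorder r)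
      = inorder l.
    by rewrite ix index_cat (negPf xnl) /= eqxx addn0 take_size_cat.
  rewrite {}ix in ij *; case/or3P: jt => [jl|/eqP jx|jr].
  + rewrite -(saturated_initial _ _ ol jl).
    rewrite (@eq_saturated_chains r _ (fun=> false)); last first.
      by move=> a ar /=; rewrite [a <= j]leqNgt (lr _ _ jl ar) andbF.
    rewrite (@eq_saturated_chains l _ (fun a => a <= j)); last first.
      by move=> a al /=; rewrite xl.
    rewrite saturated_const; case: r {IHr} or lr xr => [|rl y rr] or lr xr; rewrite ?andbT //.
    have jy := lr _ _ jl (root_inorder rl rr y).
    by rewrite ltnn [y <= j]leqNgt jy andbF andbT.
  + by rewrite jx ltnn in ij.
  + have jnl : j \notin inorder l by apply/negP => /lr/(_ jr); rewrite ltnn.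
    rewrite [RHS]negbTE; last by apply: contra jnl => /rl_maxima_sub.
    have := root_le _ _ or jr.
    case: r {IHr} or lr xr jr => [|rl y rr] or lr xr jr // yj.
    have xy := xr _ (root_inorder rl rr y).
    by rewrite ltnn xy yj !andbF.
- have inl : i \notin inorder l by apply/negP => /lr/(_ ir); rewrite ltnn.
  have xi := xr _ ir.
  have -> : take (index i (inorder l ++ x :: inorder r)) (inorder l ++ x :: inorder r)
      = inorder l ++ x :: take (index i (inorder r)) (inorder r).
    by rewrite index_cat (negPf inl) /= (ltn_eqF xi) take_cat ltnNge leq_addr /= addKn.
  have jnl : j \notin inorder l by apply/negP => /lr/(_ ir); rewrite ltnNge ltnW.
  have jr : j \in inorder r by case/or3P: jt => [|/eqP|//];
    [rewrite (negPf jnl)|move=> jx; move: ij; rewrite jx ltnNge ltnW].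
  rewrite mem_rl_maxima_cat // -cat1s mem_rl_maxima_cat; last first.
    by rewrite inE gtn_eqF // (ltn_trans xi).
  rewrite -(IHr or ir jr ij) (@eq_saturated_chains l _ (fun=> false)); last first.
    (* Left labels, [x] and the root of [r] are all at most [i], hence outside the interval. *)
    by move=> a al /=; rewrite [i < a]ltnNge ltnW // lr.
  rewrite saturated_const /=; have := root_le _ _ or ir.
  case: r {IHr jt} or lr xr ir jr => [|rl y rr] or lr xr ir jr // yi.
  by rewrite [i < x]ltnNge (ltnW xi) [i < y]ltnNge yi andbT.
Qed.

(* The unprimed points on one of the two arcs delimited by i' and j'. *)
Definition between (i j : nat) : pred nat := fun a => (i < a) (+) (j < a).

Definition kr_rel (cs : seq (seq nat)) (i j : nat) : bool := saturated cs (between i j).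

Lemma kr_relxx cs i : kr_rel cs i i.
Proof. by apply/allP => b _; apply/homogeneousP => a c _ _; rewrite /between !addbb. Qed.

Lemma kr_rel_sym cs i j : kr_rel cs i j = kr_rel cs j i.
Proof. by apply: eq_saturated => a _; rewrite /between addbC. Qed.

(** [between i k] is the exclusive or of [between i j] and [between j k]. *)
Lemma kr_rel_trans cs : transitive (kr_rel cs).
Proof.
move=> j i k /allP ij /allP jk; apply/allP => b bc; apply/homogeneousP => a c ab cb.
have /homogeneousP/(_ a c ab cb) := ij b bc; have /homogeneousP/(_ a c ab cb) := jk b bc.
by rewrite /between; do 6!case: (_ < _).
Qed.

Definition kr_block (n : nat) (cs : seq (seq nat)) (i : nat) : seq nat :=
  [seq j <- iota 1 n | kr_rel cs i j].

(** * The blocks of the complement as the output of [beta] *)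

Section KrewerasOfTree.
Variables (n : nat) (t : tree).
Hypothesis t_ordered : ordered_tree t.
Hypothesis t_perm : perm_eq (inorder t) (iota 1 n).

Local Notation w := (inorder t).
Local Notation K := (kr_rel (chains t)).
Local Notation block := (kr_block n (chains t)).

Let uniq_w : uniq w.
Proof. by rewrite (perm_uniq t_perm) iota_uniq. Qed.

Lemma mem_kr_block i j : (j \in block i) = K i j && (j \in w).
Proof. by rewrite mem_filter (perm_mem t_perm). Qed.

Lemma kr_rel_lt i j : i \in w -> j \in w -> i < j ->
  K i j = (j \in rl_maxima (take (index i w) w)).
Proof.
move=> iw jw ij; rewrite -saturated_interval //; apply: eq_saturated => a _.
by rewrite /between; case: (ltnP i a) => ia /=; lia.
Qed.

Lemma eq_kr_block i j : K i j -> block i = block j.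
Proof.
move=> ij; apply: eq_filter => k; apply/idP/idP; apply: kr_rel_trans => //.
by rewrite kr_rel_sym.
Qed.

(* Letters of the prefix of [w] before [m] that are right-to-left maxima and
   exceed [m] are related to [m], so they survive in the filtered word. *)
Lemma mu_kr_block (P : pred nat) (m : nat) :
  {in w &, forall i j, K i j -> P i = P j} -> m \in w -> P m ->
  {in w, forall x, P x -> m <= x} ->
  mu [seq x <- w | P x] m = block m /\ bmin (block m) = m.
Proof.
move=> PK mw Pm mmin; set u := take (index m w) w.
have wE : w = u ++ m :: drop (index m w).+1 w.
  by rewrite -[LHS](cat_take_drop (index m w)) (drop_nth 0) ?index_mem // nth_index.
have uw : {subset u <= w} by move=> x /mem_take.
have mu : m \notin u.
  by move: uniq_w; rewrite wE cat_uniq /= negb_or => /and3P[_ /andP[]].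
have umin : {in u, forall x, P x -> m < x}.
  move=> x xu Px; rewrite ltn_neqAle mmin ?uw // andbT.
  by apply: contraNneq mu => ->.
have -> : [seq x <- w | P x] =
    [seq x <- u | P x] ++ m :: [seq x <- drop (index m w).+1 w | P x].
  by rewrite {1}wE filter_cat /= Pm.
suff E : m :: rev (rl_maxima [seq x <- u | P x]) = block m.
  rewrite mu_min ?E -?E //; first by rewrite mem_filter negb_and mu orbT.
  by apply/allP => x; rewrite mem_filter => /andP[Px xu]; apply: umin.
rewrite (rl_maxima_filter _ _ m) //; last first.
  move=> x xu mx; rewrite -(PK m x) ?kr_rel_lt //; exact/uw/rl_maxima_sub.
(* Both sequences are strictly increasing, so it is enough to compare their elements. *)
apply: (irr_sorted_eq ltn_trans ltnn).
- rewrite /= path_sortedE; last exact: ltn_trans.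
  apply/andP; split; first by apply/allP => x; rewrite mem_rev mem_filter => /andP[].
  rewrite rev_sorted; apply: sorted_filter (rl_maxima_sorted u) => y x z /= yx zy.
  exact: ltn_trans zy yx.
- by apply: sorted_filter; [exact: ltn_trans|exact: iota_ltn_sorted].
- move=> x; rewrite inE mem_rev mem_filter mem_kr_block.
  have [->|xm] := eqVneq x m; first by rewrite kr_relxx mw.
  have [xw|xw] := boolP (x \in w); rewrite ?andbT ?andbF /=; last first.
    by apply/negbTE; apply: contra xw => /andP[_ /rl_maxima_sub/uw].
  have [mx|mx] := ltnP m x; first by rewrite kr_rel_lt.
  (* A letter below [m] related to [m] would satisfy [P], against the minimality of [m]. *)
  apply/esym/negbTE/negP => mKx.
  by move: xm; rewrite eqn_leq mx mmin // -(PK m x).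
Qed.

Lemma lambdas_cons (k : nat) (v : seq nat) : v != [::] ->
  let l := mu v (wmin v) in lambdas k.+1 v = l :: lambdas k [seq x <- v | x \notin l].
Proof. by case: v. Qed.

(** [P] marks the letters still present. It stays a union of complement blocks, because each round
    deletes exactly the block of the smallest letter present. *)
Lemma lambdas_kr_blocks (k : nat) (P : pred nat) :
  {in w &, forall i j, K i j -> P i = P j} -> size [seq x <- w | P x] <= k ->
  let L := lambdas k [seq x <- w | P x] in
  sorted (fun b c => bmin b < bmin c) L /\
  (forall b, b \in L <-> exists2 i, i \in w /\ P i & b = block i).
Proof.
elim: k P => [|k IH] P PK.
  rewrite leqn0 size_eq0 => /eqP wP0; split=> // b; split=> // -[i [iw Pi] _].
  by have : i \in [seq x <- w | P x]; [rewrite mem_filter Pi|rewrite wP0].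
move=> sk; have [wP0|wP0] := eqVneq [seq x <- w | P x] [::].
  rewrite wP0; split=> // b; split=> // -[i [iw Pi] _].
  by have : i \in [seq x <- w | P x]; [rewrite mem_filter Pi|rewrite wP0].
have [] := wminP _ wP0; set m := wmin _ => mw mmin.
have {mw} /andP[Pm mw] : P m && (m \in w) by rewrite -mem_filter.
have {}mmin : {in w, forall x, P x -> m <= x}.
  by move=> x xw Px; apply: mmin; rewrite mem_filter Px.
have [muE bminE] := mu_kr_block P m PK mw Pm mmin.
pose Q : pred nat := fun x => P x && (x \notin block m).
have mm : m \in block m by rewrite mem_kr_block kr_relxx.
have QK : {in w &, forall i j, K i j -> Q i = Q j}.
  move=> i j iw jw ij; rewrite /Q (PK i j) // !mem_kr_block iw jw !andbT; congr (_ && ~~ _).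
  by apply/idP/idP => /kr_rel_trans; apply; rewrite // kr_rel_sym.
have QE : [seq x <- [seq x <- w | P x] | x \notin block m] = [seq x <- w | Q x].
  by rewrite -filter_predI; apply: eq_filter => x; rewrite /= andbC.
have sQ : size [seq x <- w | Q x] <= k.
  rewrite -ltnS -QE size_filter; apply: leq_trans sk.
  rewrite -(count_predC (fun x => x \notin block m)) -addn1 leq_add2l -has_count.
  by apply/hasP; exists m; rewrite /= ?negbK // mem_filter Pm.
have [sL memL] := IH Q QK sQ.
have -> : lambdas k.+1 [seq x <- w | P x] = block m :: lambdas k [seq x <- w | Q x].
  by rewrite lambdas_cons // muE QE.
split.
  rewrite /= path_sortedE; last by move=> a b c; apply: ltn_trans.
  rewrite sL andbT; apply/allP => b /memL[i [iw Qi] ->].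
  rewrite bminE; set x := bmin _.
  (* Since [block i] contains [i], its [bmin] is a genuine letter and not the default value 0. *)
  have : x \in block i.
    have : i \in block i by rewrite mem_kr_block kr_relxx.
    by rewrite /x; case: (block i) => // y s _; exact: mem_head.
  rewrite mem_kr_block => /andP[ix xw].
  have /andP[Px xm] : Q x by rewrite -(QK i x).
  by rewrite ltn_neqAle mmin // andbT; apply: contraNneq xm => <-.
move=> b; rewrite inE; split.
  case/orP=> [/eqP->|/memL[i [iw /andP[Pi _]] ->]]; first by exists m.
  by exists i.
case=> i [iw Pi] ->; have [im|im] := boolP (i \in block m).
  by move: im; rewrite mem_kr_block => /andP[/eq_kr_block-> _]; rewrite eqxx.
by apply/orP; right; apply/memL; exists i => //; rewrite /Q Pi.
Qed.

Lemma beta_kr_blocks :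
  sorted (fun b c => bmin c < bmin b) (beta w) /\
  (forall b, b \in beta w <-> exists2 i, i \in w & b = block i).
Proof.
rewrite /beta -[X in lambdas _ X]filter_predT.
have [||sL memL] := lambdas_kr_blocks (size w) predT; rewrite ?filter_predT //.
rewrite filter_predT in sL memL; rewrite rev_sorted; split=> // b.
rewrite mem_rev memL; split=> -[i]; first by case=> ? _; exists i.
by exists i.
Qed.

End KrewerasOfTree.

(** * Regions of the disc *)

Section SameRegion.
Local Open Scope classical_set_scope.
Local Open Scope ring_scope.
Variables (R : realType) (n : nat).

(* Equation of the line through the points of the circle with half-angles
   [x] and [y]; for [x = y] it is the tangent. *)
Definition chord_eq (x y : R) (z : R * R) : R :=
  sin (x + y) * z.1 + cos (x + y) * z.2 - cos (y - x).

(** Sum-to-product turns the equation into two sines, whose signs locate the point relative to the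
    ends of the chord. *)
Lemma chord_eq_circle (x y u : R) :
  chord_eq x y (sin (u + u), cos (u + u)) = - 2 * (sin (u - x) * sin (u - y)).
Proof.
rewrite /chord_eq /= (_ : y - x = (u - x) - (u - y)); last by ring.
have -> : sin (x + y) * sin (u + u) + cos (x + y) * cos (u + u)
          = cos ((u - x) + (u - y)).
  rewrite (_ : u - x + (u - y) = (u + u) - (x + y)) ?cosB; ring.
by rewrite (cosB (u - x)) cosD; ring.
Qed.

Definition half_angle (t : R) : R := pi * t / n%:R.

Lemma circle_pointE (t : R) :
  circle_point n t = (sin (half_angle t + half_angle t),
                      cos (half_angle t + half_angle t)).
Proof.
rewrite /circle_point; set a := 2 * _ * _ / _.
suff -> : a = half_angle t + half_angle t by [].
by rewrite /a /half_angle; ring.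
Qed.

Lemma circle_point_norm (t : R) :
  (circle_point n t).1 ^+ 2 + (circle_point n t).2 ^+ 2 = 1.
Proof. by rewrite addrC cos2Dsin2. Qed.

Definition side (s t : R) := chord_eq (half_angle s) (half_angle t).

(** An affine function commutes with combinations of total weight 1. *)
Lemma side_convex (s t : R) (b : seq nat) (w : nat -> R) (z : R * R) :
  \sum_(i <- b) w i = 1 ->
  z.1 = \sum_(i <- b) w i * (vertex R n i).1 ->
  z.2 = \sum_(i <- b) w i * (vertex R n i).2 ->
  side s t z = \sum_(i <- b) w i * side s t (vertex R n i).
Proof.
move=> w1 z1 z2; rewrite /side /chord_eq z1 z2 -[X in _ - X = _]mulr1 -w1.
rewrite !mulr_sumr -big_split -sumrB; apply: eq_bigr => i _ /=.
by ring.
Qed.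

Lemma side_left (s t : R) : side s t (circle_point n s) = 0.
Proof. by rewrite circle_pointE /side chord_eq_circle subrr sin0 mul0r mulr0. Qed.

Lemma side_right (s t : R) : side s t (circle_point n t) = 0.
Proof. by rewrite circle_pointE /side chord_eq_circle subrr sin0 !mulr0. Qed.

Hypothesis n_gt0 : (0 < n)%N.

(** One full turn, half-open: half-angles of two of its points differ by less than [pi], where the
    sine has a constant sign. *)
Let arc (t : R) := 1 <= t < n%:R + 1.

Lemma half_angleB_bound (s t : R) : arc s -> arc t -> s < t ->
  0 < half_angle t - half_angle s < pi.
Proof.
move=> /andP[s1 sn] /andP[t1 tn] st.
have n0 : 0 < n%:R :> R by rewrite ltr0n.
have p0 := pi_gt0 R.
have -> : half_angle t - half_angle s = pi * ((t - s) / n%:R).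
  by rewrite /half_angle; ring.
apply/andP; split; first by rewrite mulr_gt0 // divr_gt0 // subr_gt0.
rewrite -[ltRHS]mulr1 ltr_pM2l // ltr_pdivrMr //; lra.
Qed.

Lemma sin_half_angleB (s t : R) : arc s -> arc t -> s < t ->
  0 < sin (half_angle t - half_angle s).
Proof. by move=> s1 t1 st; apply/sin_gt0_pi/half_angleB_bound. Qed.

Lemma side_gt0 (s t u : R) : arc s -> arc t -> arc u -> s < u < t ->
  0 < side s t (circle_point n u).
Proof.
move=> s1 t1 u1 /andP[su ut]; rewrite circle_pointE /side chord_eq_circle.
have su' := sin_half_angleB _ _ s1 u1 su.
have ut' := sin_half_angleB _ _ u1 t1 ut.
rewrite -(opprB (half_angle t)) sinN; nra.
Qed.

(** The tangent case [s = t] is included; it serves the comparison of a primed point with itself. *)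
Lemma side_lt0 (s t u : R) : arc s -> arc t -> arc u -> s <= t ->
  (u < s) || (t < u) -> side s t (circle_point n u) < 0.
Proof.
move=> s1 t1 u1 st; rewrite circle_pointE /side chord_eq_circle => /orP[us|tu].
- have us' := sin_half_angleB _ _ u1 s1 us.
  have ut' := sin_half_angleB _ _ u1 t1 (lt_le_trans us st).
  rewrite -(opprB (half_angle t)) -(opprB (half_angle s)) !sinN; nra.
have us' := sin_half_angleB _ _ s1 u1 (le_lt_trans st tu).
have ut' := sin_half_angleB _ _ t1 u1 tu.
nra.
Qed.

Lemma arc_vertex (i : nat) : (0 < i <= n)%N -> arc i%:R.
Proof.
case/andP=> i0 i_n; rewrite /arc ler1n i0 /=.
have : i%:R <= n%:R :> R by rewrite ler_nat.
lra.
Qed.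

Lemma arc_primed (i : nat) : (0 < i <= n)%N -> arc (i%:R + 2^-1).
Proof.
case/andP=> i0 i_n; rewrite /arc.
have : i%:R <= n%:R :> R by rewrite ler_nat.
have : 1 <= i%:R :> R by rewrite ler1n.
lra.
Qed.

Lemma lt_primed (a i : nat) : ((a%:R : R) < i%:R + 2^-1) = (a <= i)%N.
Proof.
case: (leqP a i) => ai.
  have : a%:R <= i%:R :> R by rewrite ler_nat.
  lra.
have : i.+1%:R <= a%:R :> R by rewrite ler_nat.
rewrite -natr1; lra.
Qed.

Lemma gt_primed (a i : nat) : (i%:R + 2^-1 < (a%:R : R)) = (i < a)%N.
Proof.
case: (ltnP i a) => ai.
  have : i.+1%:R <= a%:R :> R by rewrite ler_nat.
  rewrite -natr1; lra.
have : a%:R <= i%:R :> R by rewrite ler_nat.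
lra.
Qed.

(** In the orthonormal frame of the chord, the normal coordinate of [z] is fixed by the equation of
    the line, and the disc bounds the tangential one by half the chord length. *)
Lemma side_eq0_segment (s t : R) (z : R * R) : arc s -> arc t -> s < t ->
  disc z -> side s t z = 0 ->
  exists2 r, 0 <= r <= 1 &
    z = (1 - r) *: circle_point n s + r *: circle_point n t.
Proof.
move=> s1 t1 st; rewrite /disc /= => zd z0.
have sB := sin_half_angleB _ _ s1 t1 st.
move: z0; rewrite !circle_pointE /side /chord_eq.
set x := half_angle s in sB *; set y := half_angle t in sB *.
set S := sin (y - x) in sB *; set C := cos (y - x).
set p := sin (x + y); set q := cos (x + y).
have CS : C ^+ 2 + S ^+ 2 = 1 by rewrite cos2Dsin2.
have qp : q ^+ 2 + p ^+ 2 = 1 by rewrite cos2Dsin2.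
have xx : x + x = (x + y) - (y - x) by ring.
have yy : y + y = (x + y) + (y - x) by ring.
rewrite xx yy (sinB (x + y)) (cosB (x + y)) (sinD (x + y)).
rewrite (cosD (x + y) (y - x)) -/S -/C -/p -/q => z0.
(* The coordinate along the chord: it is [- S] at the end [s] and [S] at the end [t], whence the
   ratio chosen below. *)
set v := q * z.1 - p * z.2.
have vS : v ^+ 2 <= S ^+ 2.
  have -> : S ^+ 2 = 1 - C ^+ 2 by rewrite -CS; ring.
  have -> : v ^+ 2 = (z.1 ^+ 2 + z.2 ^+ 2) * (q ^+ 2 + p ^+ 2)
                     - (p * z.1 + q * z.2) ^+ 2 by rewrite /v; ring.
  by rewrite qp mulr1 (_ : p * z.1 + q * z.2 = C) ?lerB //; lra.
have /andP[v1 v2] : - S <= v <= S.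
  by rewrite -ler_norml -ler_sqr ?nnegrE ?normr_ge0 ?(ltW sB) // real_normK ?num_real.
have S0 : S + S != 0 by rewrite lt0r_neq0 ?addr_gt0.
exists ((S + v) / (S + S)).
  apply/andP; split; first by apply: divr_ge0; lra.
  by rewrite ler_pdivrMr ?addr_gt0 // mul1r lerD2l.
have Cz : C = p * z.1 + q * z.2 by lra.
have e1 : p * C + q * v = z.1.
  by rewrite Cz /v -[RHS]mulr1 -qp; ring.
have e2 : q * C - p * v = z.2.
  by rewrite Cz /v -[RHS]mulr1 -qp; ring.
rewrite [z]surjective_pairing; congr (_, _) => /=; rewrite /GRing.scale /=.
  by rewrite -e1; field.
by rewrite -e2; field.
Qed.

Variable p : seq (seq nat).
Hypothesis p_uniq : forall b, b \in p -> uniq b.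
Hypothesis p_range : forall b a, b \in p -> a \in b -> (0 < a <= n)%N.

Lemma chord_sub_hull (b : seq nat) (a c : nat) (r : R) : uniq b -> a \in b -> c \in b ->
  a != c -> 0 <= r <= 1 ->
  block_hull n b ((1 - r) *: vertex R n a + r *: vertex R n c).
Proof.
move=> ub ab cb ac /andP[r0 r1].
(* The weights sit on [a] and [c]; as [b] has no repetition, each is counted once. *)
exists (fun i => (1 - r) * (i == a)%:R + r * (i == c)%:R).
have single (e : nat) (t : R) (g : nat -> R) : e \in b ->
    \sum_(i <- b) t * (i == e)%:R * g i = t * g e.
  move=> eb; rewrite (bigD1_seq e) //= eqxx mulr1 big1 ?addr0 // => i /negPf->.
  by rewrite mulr0 mul0r.
have H (g : nat -> R) :
    \sum_(i <- b) ((1 - r) * (i == a)%:R + r * (i == c)%:R) * g i =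
    (1 - r) * g a + r * g c.
  by under eq_bigr do rewrite mulrDl; rewrite big_split /= !single.
split.
- by move=> i; rewrite addr_ge0 // mulr_ge0 ?ler0n ?subr_ge0.
- by have := H (fun=> 1); under eq_bigr do rewrite mulr1; rewrite !mulr1 subrK.
- by rewrite (H (fun i => (vertex R n i).1)).
- by rewrite (H (fun i => (vertex R n i).2)).
Qed.

Lemma continuous_side (s t : R) : continuous (side s t).
Proof.
move=> z; rewrite /side /chord_eq.
apply: cvgB; last exact: cvg_cst.
by apply: cvgD; apply: cvgM; [exact: cvg_cst|exact: cvg_fst|exact: cvg_cst|exact: cvg_snd].
Qed.

(** By the intermediate value property, a connected set containing both primed points meets the line
    through [a] and [c]; inside the disc this line is a chord contained in the hull of [b]. The
    bounds are [a <= i < c] because the primed point of [i] comes just after [i]. *)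
Lemma chord_separates (i j a c : nat) (b : seq nat) : b \in p -> a \in b -> c \in b ->
  (0 < i <= n)%N -> (0 < j <= n)%N -> (a < c)%N ->
  (a <= i < c)%N -> ~~ (a <= j < c)%N -> ~ same_region R n p i j.
Proof.
move=> bp ab cb i_n j_n ac ai aj [C [Ci CD Cc] Cj].
have a_n := p_range _ _ bp ab; have c_n := p_range _ _ bp cb.
have ac' : (a%:R : R) < c%:R by rewrite ltr_nat.
pose f := side a%:R c%:R.
have fi : 0 < f (primed_vertex R n i).
  by apply: side_gt0; rewrite ?arc_vertex ?arc_primed // lt_primed gt_primed.
have fj : f (primed_vertex R n j) < 0.
  apply: side_lt0; rewrite ?arc_vertex ?arc_primed ?(ltW ac') // lt_primed gt_primed.
  by move: aj; rewrite negb_and -ltnNge -leqNgt.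
have /connected_intervalP fC : connected (f @` C).
  apply: connected_continuous_connected => //.
  by apply: continuous_subspaceT => z; exact: continuous_side.
have [z Cz fz] : (f @` C) 0.
  apply: (fC (f (primed_vertex R n j)) (f (primed_vertex R n i))).
  - by exists (primed_vertex R n j).
  - by exists (primed_vertex R n i).
  - by rewrite (ltW fj) (ltW fi).
have [zd zh] := CD _ Cz.
have [r r01 zE] := side_eq0_segment _ _ z (arc_vertex _ a_n) (arc_vertex _ c_n) ac' zd fz.
apply: zh; exists b => //=; rewrite zE; apply: chord_sub_hull => //; first exact: p_uniq.
by rewrite neq_ltn ac.
Qed.

Lemma same_region_kr_rel (i j : nat) : (0 < i <= n)%N -> (0 < j <= n)%N ->
  same_region R n p i j -> kr_rel p i j.
Proof.
move=> i_n j_n ij; apply/allP => b bp; apply/homogeneousP => a c ab cb.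
apply/eqP; apply: contraT => neq; exfalso.
wlog ac : a c ab cb neq / (a < c)%N.
  move=> W; case: (ltngtP a c) => [ac|ca|ac]; first exact: (W a c).
    by apply: (W c a) => //; rewrite eq_sym.
  by rewrite ac eqxx in neq.
(* [between i j] differs at [a] and [c] exactly when one and only one of [i], [j] lies in the
   interval from [a] (included) to [c] (excluded). *)
have [ai|ai] := boolP (a <= i < c)%N.
  apply: (chord_separates i j a c b) => //.
  by apply: contraNN neq; rewrite /between; lia.
have ji : same_region R n p j i.
  by case: ij => C [? ? ?] ?; exists C.
apply: (chord_separates j i a c b) => //.
by apply: contraNT neq; rewrite /between; lia.
Qed.

(** All vertices of the block lie strictly on one side, and some weight is positive because the
    weights sum to 1. *)
Lemma side_primed_neq0 (i j : nat) (b : seq nat) (z : R * R) :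
  (0 < i <= n)%N -> (0 < j <= n)%N -> (i <= j)%N -> b \in p ->
  homogeneous (between i j) b ->
  block_hull n b z -> side (i%:R + 2^-1) (j%:R + 2^-1) z != 0.
Proof.
move=> i_n j_n ij bp ss [w [w0 w1 z1 z2]].
rewrite (side_convex _ _ _ _ _ w1 z1 z2).
set s := i%:R + _; set t := j%:R + _.
have st : s <= t by rewrite lerD2r ler_nat.
have pos a : a \in b -> (i < a <= j)%N -> 0 < side s t (vertex R n a).
  move=> ab aij; apply: side_gt0; rewrite ?arc_vertex ?arc_primed ?(p_range _ _ bp ab) //.
  case/andP: aij => ia aj; rewrite gt_primed ia /=.
  by rewrite lt_primed aj.
have neg a : a \in b -> ~~ (i < a <= j)%N -> side s t (vertex R n a) < 0.
  move=> ab aij; apply: side_lt0; rewrite ?arc_vertex ?arc_primed ?(p_range _ _ bp ab) //.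
  by rewrite gt_primed lt_primed; lia.
have : has (fun a => 0 < w a) b.
  apply: contraPT w1 => /hasPn w1 w1'.
  have : (1 : R) <= 0.
    by rewrite -w1' big_seq sumr_le0 // => a /w1; rewrite -leNgt.
  by rewrite ler10.
case/hasP=> a0 a0b wa0.
have [aij|aij] := boolP (i < a0 <= j)%N.
  have ge0 a : a \in b -> 0 <= w a * side s t (vertex R n a).
    move=> ab; rewrite mulr_ge0 // ltW // pos //.
    by have /homogeneousP/(_ _ _ a0b ab) := ss; rewrite /between; lia.
  rewrite big_seq psumr_eq0 //; apply/allPn; exists a0 => //.
  by rewrite a0b /= lt0r_neq0 // mulr_gt0 // pos.
rewrite -oppr_eq0 -sumrN.
have ge0 a : a \in b -> 0 <= - (w a * side s t (vertex R n a)).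
  move=> ab; rewrite -mulrN mulr_ge0 // oppr_ge0 ltW // neg //.
  by have /homogeneousP/(_ _ _ a0b ab) := ss; rewrite /between; lia.
rewrite big_seq psumr_eq0 //; apply/allPn; exists a0 => //.
by rewrite a0b /= lt0r_neq0 // -mulrN mulr_gt0 // oppr_gt0 neg.
Qed.

Lemma kr_rel_same_region (i j : nat) : (0 < i <= n)%N -> (0 < j <= n)%N ->
  (i <= j)%N -> kr_rel p i j -> same_region R n p i j.
Proof.
move=> i_n j_n ij /allP ss.
set P := primed_vertex R n i; set Q := primed_vertex R n j.
pose g (r : R) : R * R := (1 - r) *: P + r *: Q.
exists (g @` `[0, 1]); last first.
  by exists 1; rewrite /= ?in_itv /= ?ler01 ?lexx // /g subrr scale0r add0r scale1r.
split.
- by exists 0; rewrite /= ?in_itv /= ?ler01 ?lexx // /g subr0 scale0r addr0 scale1r.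
- move=> _ [r /= r01 <-]; rewrite in_itv /= in r01; case/andP: r01 => r0 r1.
  split.
    have P1 := circle_point_norm (i%:R + 2^-1).
    have Q1 := circle_point_norm (j%:R + 2^-1).
    rewrite -/(primed_vertex R n i) -/P in P1.
    rewrite -/(primed_vertex R n j) -/Q in Q1.
    rewrite /disc /g /= /GRing.scale /=.
    (* Convexity of the disc, from the exact defect of convexity of the squared norm. *)
    have -> : ((1 - r) * P.1 + r * Q.1) ^+ 2 + ((1 - r) * P.2 + r * Q.2) ^+ 2
      = (1 - r) * (P.1 ^+ 2 + P.2 ^+ 2) + r * (Q.1 ^+ 2 + Q.2 ^+ 2)
        - r * (1 - r) * ((P.1 - Q.1) ^+ 2 + (P.2 - Q.2) ^+ 2) by ring.
    rewrite P1 Q1 !mulr1 subrK gerBl.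
    by rewrite mulr_ge0 ?addr_ge0 ?sqr_ge0 // mulr_ge0 // subr_ge0.
  move=> [b /= bp /(side_primed_neq0 i j)]/(_ i_n j_n ij bp (ss _ bp))/eqP; apply.
  set s := i%:R + _; set t := j%:R + _.
  have -> : side s t (g r) = (1 - r) * side s t P + r * side s t Q.
    by rewrite /side /chord_eq /g /= /GRing.scale /=; ring.
  by rewrite side_left side_right !mulr0 addr0.
- apply: connected_continuous_connected; first exact: segment_connected.
  apply: continuous_subspaceT => r; rewrite /g.
  apply: cvgD; apply: cvgZr_tmp; last exact: cvg_id.
  by apply: cvgB; [exact: cvg_cst|exact: cvg_id].
Qed.

Lemma same_regionP (i j : nat) : (0 < i <= n)%N -> (0 < j <= n)%N ->
  same_region R n p i j <-> kr_rel p i j.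
Proof.
move=> i_n j_n; split; first exact: same_region_kr_rel.
case: (leqP i j) => ij ss; first exact: kr_rel_same_region.
have [|C [? ? ?] ?] := kr_rel_same_region j i j_n i_n (ltnW ij); last by exists C.
by rewrite kr_rel_sym.
Qed.

End SameRegion.

(** * Inverting [phi] and closing the triangle *)

Lemma labeled_tree_exists (n : nat) (p : seq (seq nat)) : NCCP n p ->
  exists2 t, labeled_trees n t & phi t = p.
Proof.
case=> p0 pn ps pd.
have [|t it tE] := increasing_tree_exists (flatten p).
  by rewrite (perm_uniq pn) iota_uniq.
by exists t; rewrite /labeled_trees /phi /= tE ?it // runs_flatten.
Qed.

(** On the image of [phi] the partial inverse takes its values among the labeled trees and is a
    right inverse. *)
Lemma phi_invP (n : nat) (p : seq (seq nat)) : NCCP n p ->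
  labeled_trees n (phi_inv n p) /\ phi (phi_inv n p) = p.
Proof.
case/labeled_tree_exists=> t tn <-.
have im : (phi @` labeled_trees n)%classic (phi t) by exists t.
split; last by apply: pinvK; rewrite inE.
have surj : set_surj (labeled_trees n) (phi @` labeled_trees n)%classic phi by move=> b.
exact: (surjpinv_image_sub surj (ex_intro2 _ _ (phi t) im erefl)).
Qed.

Lemma kreweras_blocks (R : realType) (n : nat) (p q : seq (seq nat)) :
  (0 < n)%N -> perm_eq (flatten p) (iota 1 n) ->
  sorted (fun b c => bmin c < bmin b) q ->
  (forall b, b \in q <-> exists2 i, i \in iota 1 n & b = kr_block n p i) ->
  kreweras R n (Defs.canonical p) = q.
Proof.
move=> n0 pn sq qE; apply: canonicalE => //; first exact: undup_uniq.
set p' := Defs.canonical p.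
have mem_p' b : (b \in p') = (b \in p) by rewrite mem_sort.
have range i : (0 < i <= n) = (i \in iota 1 n) by rewrite mem_iota add1n ltnS.
have p'_uniq b : b \in p' -> uniq b.
  rewrite mem_p' => bp; have : uniq (flatten p) by rewrite (perm_uniq pn) iota_uniq.
  by case/splitPr: bp => p1 p2; rewrite flatten_cat /= !cat_uniq => /and3P[_ _ /and3P[]].
have p'_range b a : b \in p' -> a \in b -> (0 < a <= n).
  rewrite mem_p' range -(perm_mem pn) => bp ab.
  by apply/flattenP; exists b.
have blockE i : i \in iota 1 n ->
    [seq j <- iota 1 n | `[< same_region R n p' i j >]] = kr_block n p i.
  move=> iota_i; apply: eq_in_filter => j iota_j.
  (* The relation does not depend on the order in which the blocks are listed. *)
  have -> : kr_rel p i j = kr_rel p' i j by apply/esym/perm_all; rewrite perm_sort.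
  apply/asboolP/idP => /same_regionP; apply; by rewrite ?range.
move=> b; rewrite mem_undup; apply/mapP/idP => [[i iota_i ->]|/qE[i iota_i ->]].
  by apply/qE; exists i; rewrite // blockE.
by exists i; rewrite // blockE.
Qed.

Theorem proposition3p41 (R : realType) (n : nat) (p : seq (seq nat)) :
  (1 <= n)%N -> NCCP312 n p ->
  kreweras R n (psi (phi_inv n p)) = beta (flatten p).
Proof.
move=> n_gt0 [pn p312]; have [] := phi_invP n p pn; set t := phi_inv n p.
case/andP=> it tn tE; have fpE : flatten p = inorder t by rewrite -tE flatten_runs.
rewrite fpE in p312 *.
have ot : ordered_tree t.
  by apply: avoids312_ordered; rewrite // (perm_uniq tn) iota_uniq.
have [sb memb] := beta_kr_blocks n t ot tn.
apply: kreweras_blocks => //; first exact: perm_trans (perm_chains t) tn.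
by move=> b; rewrite memb; split=> -[i iw ->]; exists i; rewrite // (perm_mem tn) in iw *.
Qed.
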